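(* Let $B=(V,E)$ be a generalized Bratteli diagram such that the set of vertices on each level is identified with $\mathbb N$. Suppose that there exists a level $N$ such that, starting from that level, every vertex (that is, every vertex of $V_n$ for every $n\ge N$, $n\geq 1$) has at least two incoming edges which are slanted from right to left. Then $B$ admits an order such that the set of infinite minimal paths and the set of infinite maximal paths are both empty.
   Context: A generalized Bratteli diagram is a graded graph $B=(V,E)$ with $V=\bigsqcup_{i\ge0}V_i$, $E=\bigsqcup_{i\ge0}E_i$, where every level $V_i$ is countably infinite, $E_i$ is a countable set of edges from $V_i$ to $V_{i+1}$ with source and range maps $s,r$ satisfying $s(E_i)=V_i$, $r(E_i)=V_{i+1}$, and $|r^{-1}(v)|<\infty$ for every $v\in V\setminus V_0$. An infinite path is a sequence $x=(x_i)_{i\ge0}$ with $x_i\in E_i$ and $r(x_i)=s(x_{i+1})$. With every level identified with $\mathbb N=\{1,2,\dots\}$, an edge $e$ is slanted from right to left if $r(e)<s(e)$ (comparison as natural numbers). An order on $B$ is a choice of a linear order on each finite set $r^{-1}(v)$, $v\in V\setminus V_0$. An infinite path $(x_i)$ is minimal (maximal) if every $x_i$ is the minimal (maximal) element of $r^{-1}(r(x_i))$. *)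

(* Defs.v *)
From mathcomp Require Import all_boot.
From mathcomp Require Import boolp classical_sets functions cardinality.

Set Implicit Arguments.
Unset Strict Implicit.
Unset Printing Implicit Defensive.

Local Open Scope classical_set_scope.
Local Open Scope card_scope.

(* The disjoint unions V = V_0 + V_1 + ... and E = E_0 + E_1 + ... are encoded
   by families of types. [r^{-1}(v)] is required to be finite only for
   v outside V_0, i.e., for v : V_{i+1}. *)
Record gen_bratteli_diagram := GenBratteliDiagram {
  vertex : nat -> Type ;
  edge : nat -> Type ;
  src : forall i, edge i -> vertex i ;
  rng : forall i, edge i -> vertex i.+1 ;
  vertex_card : forall i, [set: vertex i] #= [set: nat] ;
  edge_countable : forall i, countable [set: edge i] ;
  src_surj : forall i, @src i @` [set: edge i] = [set: vertex i] ;
  rng_surj : forall i, @rng i @` [set: edge i] = [set: vertex i.+1] ;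
  rng_finite : forall i (v : vertex i.+1), finite_set (@rng i @^-1` [set v])
}.

Arguments src {_ i} _.
Arguments rng {_ i} _.

Section Diagram.
Variable B : gen_bratteli_diagram.

Definition incoming i (v : vertex B i.+1) : set (edge B i) :=
  rng @^-1` [set v].

(* The vertices of each level are labelled by {1, 2, ...}. *)
Definition vertex_labelling (lab : forall i, vertex B i -> nat) :=
  forall i, set_bij [set: vertex B i] [set n | 0 < n] (lab i).

Definition slanted_right_to_left (lab : forall i, vertex B i -> nat)
    i (e : edge B i) :=
  lab i.+1 (rng e) < lab i (src e).

Definition linear_order_on T (A : set T) (R : T -> T -> Prop) :=
  [/\ forall x, A x -> R x x,
      forall x y, A x -> A y -> R x y -> R y x -> x = y,
      forall x y z, A x -> A y -> A z -> R x y -> R y z -> R x z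
    & total_on A R].

(* Only the restriction of [ord_le v] to [incoming v] is meaningful. *)
Record bratteli_order := BratteliOrder {
  ord_le : forall i, vertex B i.+1 -> edge B i -> edge B i -> Prop ;
  ord_leP : forall i (v : vertex B i.+1),
    linear_order_on (incoming v) (ord_le v)
}.

Definition infinite_path : set (forall i, edge B i) :=
  [set x : forall i, edge B i | forall i, rng (x i) = src (x i.+1)].

Definition minimal_edge (w : bratteli_order) i (e : edge B i) :=
  forall f, incoming (rng e) f -> ord_le w (rng e) e f.

Definition maximal_edge (w : bratteli_order) i (e : edge B i) :=
  forall f, incoming (rng e) f -> ord_le w (rng e) f e.

Definition minimal_paths (w : bratteli_order) : set (forall i, edge B i) :=
  [set x | infinite_path x /\ forall i, minimal_edge w (x i)].

Definition maximal_paths (w : bratteli_order) : set (forall i, edge B i) :=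
  [set x | infinite_path x /\ forall i, maximal_edge w (x i)].

End Diagram.

(* Main.v *)
Require Import Defs.
From mathcomp Require Import all_boot all_order.
From mathcomp Require Import boolp classical_sets functions cardinality.

(** Order the edges entering each vertex of a level [i.+1 >= N] so that both
    the smallest and the largest one are slanted from right to left; two
    distinct slanted edges are available, so one can be put at each end
    ([linear_order_with_endpoints]).  Along a path all of whose edges are
    minimal, or all of whose edges are maximal, the labels of the visited
    vertices then strictly decrease from level [N] on, and natural numbers
    admit no infinite descent ([no_eventually_slanted_path]). *)

Import Order.TTheory.
Local Open Scope classical_set_scope.

Lemma linear_order_pullback (d : Order.disp_t) (K : orderType d) (T : Type)
    (key : T -> K) (A : set T) :
  injective key -> linear_order_on A (fun x y => (key x <= key y)%O).
Proof.
move=> key_inj; split=> [x _ //|x y _ _ xy yx|x y z _ _ _ xy yz|x y _ _].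
- by apply/key_inj/le_anti; rewrite xy yx.
- exact: le_trans xy yz.
- by apply/orP; exact: le_total.
Qed.

Lemma countableT_inj (T : Type) :
  countable [set: T] -> exists f : T -> nat, injective f.
Proof.
move=> /countable_injP [f f_inj]; exists f => x y fxy.
by apply: f_inj => //; rewrite inE.
Qed.

(** The order compares first the position (first, middle or last) and then, to
    separate the middle elements, their values under an injection into [nat];
    the two distinguished elements are alone in their positions. *)
Lemma linear_order_with_endpoints (T : Type) (A : set T) (a b : T) :
    countable [set: T] -> a <> b ->
  exists R : T -> T -> Prop,
    [/\ linear_order_on A R, forall x, R a x & forall x, R x b].
Proof.
move=> /countableT_inj [f f_inj] a_neq_b.
pose pos x := if `[< x = a >] then 0 else if `[< x = b >] then 2 else 1.
pose key x : (nat *l nat)%type := (pos x, f x).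
have pos_a : pos a = 0 by rewrite /pos asboolT.
have pos_b : pos b = 2 by rewrite /pos asboolF ?asboolT // => /esym.
have key_inj : injective key by move=> x y [_ /f_inj].
exists (fun x y => (key x <= key y)%O); split=> [|x|x].
- exact: linear_order_pullback.
- rewrite leEprodlexi /= pos_a /pos.
  by case: asboolP => [->|_]; [rewrite !lexx|case: ifP].
- rewrite leEprodlexi /= pos_b /pos; case: asboolP => // _.
  by case: asboolP => [->|//]; rewrite !lexx.
Qed.

Lemma no_eventually_slanted_path (B : gen_bratteli_diagram)
    (lab : forall i, vertex B i -> nat) (N : nat) (x : forall i, edge B i) :
    infinite_path x ->
  ~ (forall i, N <= i.+1 -> slanted_right_to_left lab (x i)).
Proof.
move=> x_path x_slanted.
have descent k : lab _ (src (x (N + k))) + k <= lab _ (src (x N)).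
  elim: k => [|k IHk]; first by rewrite !addn0.
  apply: leq_trans IHk; rewrite addnS -addSn leq_add2r addnS -x_path.
  by apply: x_slanted; rewrite (leq_trans (leq_addr k N)).
have := descent (lab _ (src (x N))).+1.
by move/(leq_trans (leq_addl _ _)); rewrite ltnn.
Qed.

Theorem theorem4p1 (B : gen_bratteli_diagram)
    (lab : forall i, vertex B i -> nat)
    (hlab : vertex_labelling lab)
    (hslant : exists N : nat, forall i, N <= i.+1 ->
       forall v : vertex B i.+1, exists e1 e2 : edge B i,
         [/\ e1 <> e2, incoming v e1, incoming v e2,
             slanted_right_to_left lab e1 & slanted_right_to_left lab e2]) :
  exists w : bratteli_order B,
    minimal_paths w = set0 /\ maximal_paths w = set0.
Proof.
have [N slantN] := hslant.
have local_order i (v : vertex B i.+1) : exists R : edge B i -> edge B i -> Prop,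
    linear_order_on (incoming v) R /\
    (N <= i.+1 -> forall e, incoming v e ->
       ((forall f, incoming v f -> R e f) -> slanted_right_to_left lab e) /\
       ((forall f, incoming v f -> R f e) -> slanted_right_to_left lab e)).
  have [leN|ltN] := leqP N i.+1; last first.
    have [f f_inj] := countableT_inj _ (edge_countable B i).
    exists (fun x y => (f x <= f y)%O); split=> [|//].
    exact: linear_order_pullback.
  have [e1 [e2 [e12 ve1 ve2 slant1 slant2]]] := slantN i leN v.
  have [R [Rlin Re1 Re2]] :=
    linear_order_with_endpoints _ (incoming v) _ _ (edge_countable B i) e12.
  exists R; split=> // _ e ve; have [_ Ranti _ _] := Rlin.
  split=> e_extremal.
  - by rewrite (Ranti e e1) //; exact: e_extremal.
  - by rewrite (Ranti e e2) //; exact: e_extremal.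
pose w := @BratteliOrder B (fun i v => projT1 (cid (local_order i v)))
  (fun i v => proj1 (projT2 (cid (local_order i v)))).
have extremal_slanted i (e : edge B i) (leN : N <= i.+1) :=
  proj2 (projT2 (cid (local_order i (rng e)))) leN e erefl.
exists w; split; apply/seteqP; split=> // x [x_path x_extremal];
  apply: (no_eventually_slanted_path _ lab N _ x_path) => i leN.
- exact: (proj1 (extremal_slanted i (x i) leN)) (x_extremal i).
- exact: (proj2 (extremal_slanted i (x i) leN)) (x_extremal i).
Qed.
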